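(* Let $f$ belong to the class $C$ of normalized convex univalent functions. If $\Theta\big(f(\mathbb{D})\big)=\pi$, then $f$ is a half-plane mapping, that is, $f(\mathbb{D})$ is a half-plane.
   Context: $\mathbb{D}$ is the open unit disk. $S$ is the class of univalent (injective holomorphic) functions $f(z)=z+\sum_{n=2}^\infty a_nz^n$ in $\mathbb{D}$. $C\subset S$ consists of those $f\in S$ whose range $f(\mathbb{D})$ is a convex set. The angle at infinity of a convex domain $\Omega$ is $$\Theta(\Omega)=\inf\{\theta\in[0,\pi]:\ \Omega\text{ is contained in a sector of aperture }\theta\},$$ where a sector of aperture $\theta\in(0,\pi]$ is a set of the form $\{w_0+\rho e^{i\varphi}:\rho>0,\ |\varphi-\varphi_0|<\theta/2\}$ with $w_0\in\mathbb{C}$, $\varphi_0\in\mathbb{R}$, and a sector of aperture zero means an infinite strip (the region between two parallel lines). *)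

(* Defs.v *)
(* Stdlib world (Coquelicot): [C] is Coquelicot's type of complex numbers. *)
From Stdlib Require Import Reals.
From Coquelicot Require Import Coquelicot.

Open Scope R_scope.

Definition unit_disk (z : C) : Prop := Cmod z < 1.

Definition image (f : C -> C) (A : C -> Prop) (w : C) : Prop :=
  exists z : C, A z /\ w = f z.

Definition included (A B : C -> Prop) : Prop := forall w : C, A w -> B w.

Definition same_set (A B : C -> Prop) : Prop := forall w : C, A w <-> B w.

Definition convex_set (A : C -> Prop) : Prop :=
  forall (u v : C) (t : R), A u -> A v -> 0 <= t <= 1 ->
    A (RtoC (1 - t) * u + RtoC t * v)%C.

(* Taking the scalars of [ex_derive] in [C_AbsRing] makes it complex
   differentiability. *)
Definition holomorphic_on (A : C -> Prop) (f : C -> C) : Prop :=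
  forall z : C, A z -> @ex_derive C_AbsRing C_NormedModule f z.

Definition injective_on (A : C -> Prop) (f : C -> C) : Prop :=
  forall z1 z2 : C, A z1 -> A z2 -> f z1 = f z2 -> z1 = z2.

Definition univalent_on (A : C -> Prop) (f : C -> C) : Prop :=
  holomorphic_on A f /\ injective_on A f.

(* Functions on the disk are total functions [C -> C] of which only the values
   on the disk matter.  The coefficients [a] give the normalized expansion
   f(z) = z + a_2 z^2 + a_3 z^3 + ... *)
Definition class_S (f : C -> C) : Prop :=
  univalent_on unit_disk f /\
  exists a : nat -> C,
    a 0%nat = RtoC 0 /\ a 1%nat = RtoC 1 /\
    forall z : C, unit_disk z -> @is_pseries C_AbsRing C_NormedModule a z (f z).

Definition class_C (f : C -> C) : Prop :=
  class_S f /\ convex_set (image f unit_disk).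

(* e^{i phi} *)
Definition cis (phi : R) : C := (cos phi, sin phi).

Definition sector (w0 : C) (phi0 theta : R) (w : C) : Prop :=
  exists rho phi : R,
    0 < rho /\ Rabs (phi - phi0) < theta / 2 /\
    w = (w0 + RtoC rho * cis phi)%C.

(* Re (conj u * w) is the Euclidean inner product of u and w, so its level sets
   are the lines orthogonal to u. *)
Definition strip (u : C) (c1 c2 : R) (w : C) : Prop :=
  c1 < Re (Cconj u * w)%C < c2.

Definition half_plane (u : C) (c : R) (w : C) : Prop :=
  c < Re (Cconj u * w)%C.

Definition is_half_plane (A : C -> Prop) : Prop :=
  exists (u : C) (c : R), u <> RtoC 0 /\ same_set A (half_plane u c).

Definition is_sector_of_aperture (theta : R) (A : C -> Prop) : Prop :=
  (0 < theta <= PI /\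
   exists (w0 : C) (phi0 : R), same_set A (sector w0 phi0 theta)) \/
  (theta = 0 /\
   exists (u : C) (c1 c2 : R),
     u <> RtoC 0 /\ c1 < c2 /\ same_set A (strip u c1 c2)).

(* The infimum is taken in the extended reals, so it is +oo when no sector
   contains [Omega] (e.g. for the whole plane). *)
Definition angle_at_infinity (Omega : C -> Prop) : Rbar :=
  Glb_Rbar (fun theta : R =>
    0 <= theta <= PI /\
    exists A : C -> Prop, is_sector_of_aperture theta A /\ included Omega A).

(* Main.v *)
Require Import Defs.
From Stdlib Require Import Reals Lra Lia Psatz Classical.
From Coquelicot Require Import Coquelicot.

(** Write Omega for the convex set f(D).  The proof has a part about plane
    convex sets and a part about power series.

    Convexity.  An angle equal to PI, rather than +oo, means that some sector
    contains Omega and that no sector of smaller aperture does, so Omega lies in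
    a half-plane, with inner normal u say.  Let m be the infimum of the linear
    form <u, w> over Omega.  Suppose that a point p with <u, p> > m were missing
    from Omega.  Separating p from Omega ([convex_separation]) gives a second
    half-plane that contains Omega and has p on its boundary.  If its normal is
    not parallel to u, the two half-planes meet in a sector of aperture < PI
    ([wedge_in_sector]); if its normal is opposite to u, Omega lies in a strip,
    which has aperture 0; if it has the direction of u, then <u, w> >= <u, p> > m
    on Omega, against the choice of m.  Hence Omega contains the open half-plane
    <u, w> > m and is contained in the closed one ([convex_angle_PI]).

    Analysis.  It remains to see that no point f(z0) lies on the boundary line.
    At such a z0 the function Re (conj u * f) would have a minimum, and an
    injective analytic function has none ([univalent_no_minimum]).  This replaces
    the open mapping theorem, and avoids expanding f again about z0.  Divided
    differences at z0 turn a power series about 0 into a power series about 0, on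
    the same disk |z| < r, with coefficient bound M / r^n multiplied by only
    1 / (r - |z0|) ([divided_difference]).  If f = f(z0) + (z - z0)^k g with
    k >= 1 and g(z0) <> 0, then along a suitable ray from z0 the term
    (z - z0)^k g(z0) pushes Re (conj u * f) below its minimum; so g(z0) = 0 and
    another factor z - z0 splits off ([vanishing_to_all_orders]).  The k-th
    factor g is O((r - |z0|)^-k), so letting k tend to infinity shows that f is
    constant on |z - z0| <= (r - |z0|) / 2, contrary to injectivity. *)

(** * Power series with geometric coefficient bounds *)

(** The two structure arguments fix complex scalars: left implicit, they may be
    inferred as those of the real vector space R * R. *)
Definition csum (c : nat -> C) (l : C) : Prop :=
  @is_series C_AbsRing C_NormedModule c l.

Lemma csum_unique c l l' : csum c l -> csum c l' -> l = l'.
Proof.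
  intros H H'.
  exact (filterlim_locally_unique (V := C_NormedModule) _ _ _ H H').
Qed.

Lemma csum_geometric_bound (c : nat -> C) (K q : R) :
  0 <= q < 1 -> (forall n, Cmod (c n) <= K * q ^ n) ->
  exists l, csum c l /\ Cmod l <= K / (1 - q).
Proof.
  intros Hq Hc.
  assert (Hg : is_series (fun n => K * q ^ n) (K / (1 - q))).
  { apply (is_series_scal (K := R_AbsRing) (V := R_NormedModule) K).
    apply is_series_geom. rewrite Rabs_pos_eq; lra. }
  destruct (ex_series_le (V := C_CompleteNormedModule) c (fun n => K * q ^ n))
    as [l Hl].
  { intros n. exact (Hc n). }
  { exists (K / (1 - q)). exact Hg. }
  exists l; split; [exact Hl|].
  change (Rbar_le (Cmod l) (K / (1 - q))).
  apply (is_lim_seq_le (fun n => Cmod (sum_n (G := C_NormedModule) c n))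
           (fun n => sum_n (fun n => K * q ^ n) n)).
  - intros n.
    eapply Rle_trans; [apply (norm_sum_n_m (V := C_NormedModule))|].
    apply sum_n_m_le. exact Hc.
  - apply (filterlim_comp _ _ _ _ _ _ _ _ Hl).
    apply (filterlim_norm (V := C_NormedModule)).
  - exact Hg.
Qed.

(** A value for every series makes the coefficients of a divided difference, and
    its values, into functions. *)
Definition csum_value (c : nat -> C) : C :=
  iota (T := C_CompleteNormedModule) (csum c).

Lemma csum_value_correct c l : csum c l -> csum_value c = l.
Proof.
  intros H. apply (iota_unique (V := C_CompleteNormedModule)); [|exact H].
  intros y Hy. exact (csum_unique _ _ _ Hy H).
Qed.

Lemma csum_terms_bounded (c : nat -> C) (l : C) :
  csum c l -> exists M, forall n, Cmod (c n) <= M.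
Proof.
  intros H.
  destruct (filterlim_bounded (V := C_NormedModule)
              (sum_n (G := C_NormedModule) c)) as [M HM].
  { exists l. exact H. }
  assert (HM' : forall n, Cmod (sum_n (G := C_NormedModule) c n) <= M).
  { exact HM. }
  exists (2 * M). intros [|n].
  - specialize (HM' 0%nat). rewrite sum_O in HM'.
    generalize (Cmod_ge_0 (c 0%nat)). lra.
  - generalize (HM' n) (HM' (S n)). rewrite sum_Sn. intros H1 H2.
    replace (c (S n)) with
      (plus (sum_n (G := C_NormedModule) c n) (c (S n))
       + - sum_n (G := C_NormedModule) c n)%C.
    2:{ change (@plus C_NormedModule) with Cplus. ring. }
    eapply Rle_trans; [apply Cmod_triangle|].
    rewrite Cmod_opp. lra.
Qed.

Lemma csum_shift c l : csum c l -> csum (fun n => c (S n)) (l - c 0%nat)%C.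
Proof.
  intros H. apply (is_series_incr_1 (V := C_NormedModule)).
  replace (plus _ _) with l; [exact H|].
  change (l = (l - c 0%nat) + c 0%nat)%C. ring.
Qed.

(** On the disk |z| < r, f is the sum of a power series about 0 whose coefficients
    satisfy the Cauchy estimate |a_n| <= M / r^n.  The bound M is a parameter
    because the argument has to follow it through repeated divided differences. *)
Definition expands (M r : R) (f : C -> C) : Prop :=
  exists a : nat -> C,
    (forall n, Cmod (a n) <= M * (/ r) ^ n) /\
    forall z, Cmod z < r -> csum (fun n => z ^ n * a n)%C (f z).

Lemma pow_n_Cpow (z : C) n : @pow_n C_Ring z n = (z ^ n)%C.
Proof. induction n; simpl; [|rewrite IHn]; reflexivity. Qed.

Lemma ratio_lt1 r (z : C) : Cmod z < r -> 0 <= Cmod z / r < 1.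
Proof.
  intros Hz. generalize (Cmod_ge_0 z); intros H0. split.
  - apply Rdiv_le_0_compat; lra.
  - apply Rlt_div_l; lra.
Qed.

Lemma term_bound M r (a : nat -> C) z n :
  (forall n, Cmod (a n) <= M * (/ r) ^ n) ->
  Cmod (z ^ n * a n) <= M * (Cmod z / r) ^ n.
Proof.
  intros Ha. rewrite Cmod_mult, Cmod_pow.
  unfold Rdiv. rewrite Rpow_mult_distr.
  replace (M * (Cmod z ^ n * (/ r) ^ n)) with (Cmod z ^ n * (M * (/ r) ^ n)) by ring.
  apply Rmult_le_compat_l; [apply pow_le, Cmod_ge_0 | apply Ha].
Qed.

Lemma expands_bound M r f z :
  expands M r f -> Cmod z < r -> Cmod (f z) <= M / (1 - Cmod z / r).
Proof.
  intros [a [Ha Hf]] Hz.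
  destruct (csum_geometric_bound (fun n => z ^ n * a n)%C M (Cmod z / r))
    as [l [Hl Hb]].
  - apply ratio_lt1, Hz.
  - intros n. apply term_bound, Ha.
  - rewrite (csum_unique _ _ _ (Hf z Hz) Hl). exact Hb.
Qed.

(** If f = sum a_n z^n, the quotient is sum b_n z^n with
    b_n = sum_k a_{n+1+k} z0^k, because b_n - z0 b_{n+1} = a_{n+1}.  Summing the
    Cauchy estimates of the a_n as a geometric series gives those of the b_n with
    the same radius r: only the constant deteriorates, by 1 / (r - |z0|). *)
Lemma divided_difference M r f z0 :
  expands M r f -> Cmod z0 < r ->
  exists g, expands (M / (r - Cmod z0)) r g /\
    forall z, Cmod z < r -> f z = (f z0 + (z - z0) * g z)%C.
Proof.
  intros [a [Ha Hf]] Hz0.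
  assert (Hr : 0 < r) by (generalize (Cmod_ge_0 z0); lra).
  (* the coefficients b_n = a_{n+1} + a_{n+2} z0 + a_{n+3} z0^2 + ... *)
  set (b := fun n => csum_value (fun k => z0 ^ k * a (S (n + k)))%C).
  assert (Htail : forall n, csum (fun k => z0 ^ k * a (S (n + k)))%C (b n)
                     /\ Cmod (b n) <= M / (r - Cmod z0) * (/ r) ^ n).
  { intros n.
    destruct (csum_geometric_bound (fun k => z0 ^ k * a (S (n + k)))%C
      (M * (/ r) ^ (S n)) (Cmod z0 / r)) as [l [Hl Hb]].
    - apply ratio_lt1, Hz0.
    - intros k.
      apply (term_bound (M * (/ r) ^ S n) r (fun k => a (S (n + k)))).
      intros m. rewrite Rmult_assoc, <- pow_add. apply Ha.
    - unfold b. rewrite (csum_value_correct _ _ Hl). split; [exact Hl|].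
      replace (M / (r - Cmod z0) * (/ r) ^ n) with
        (M * (/ r) ^ S n / (1 - Cmod z0 / r)); [exact Hb|].
      simpl. field. repeat split; lra. }
  assert (Hb : forall n, Cmod (b n) <= M / (r - Cmod z0) * (/ r) ^ n).
  { intros n. apply Htail. }
  assert (Hb1 : forall n, csum (fun k => z0 ^ k * a (S (n + k)))%C (b n)).
  { intros n. apply Htail. }
  clearbody b. clear Htail.
  assert (Hrec : forall n, (b n - z0 * b (S n) = a (S n))%C).
  { intros n.
    assert (H1 := csum_shift _ _ (Hb1 n)).
    assert (H2 := is_series_scal (V := C_NormedModule) z0 _ _ (Hb1 (S n))).
    assert (E : (b n - z0 ^ 0 * a (S (n + 0)) = z0 * b (S n))%C).
    { apply (csum_unique _ _ _ H1).
      refine (is_series_ext (V := C_NormedModule) _ _ _ _ H2).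
      intros k. change (z0 * (z0 ^ k * a (S (S n + k))) = z0 ^ S k * a (S (n + S k)))%C.
      rewrite Cpow_S. replace (n + S k)%nat with (S n + k)%nat by lia. ring. }
    rewrite <- E, Nat.add_0_r. simpl. ring. }
  assert (Hb0 : (f z0 = a 0%nat + z0 * b 0%nat)%C).
  { assert (H1 := csum_shift _ _ (Hf z0 Hz0)). simpl in H1.
    assert (H2 := is_series_scal (V := C_NormedModule) z0 _ _ (Hb1 0%nat)).
    assert (E : (f z0 - 1 * a 0%nat = z0 * b 0%nat)%C).
    { apply (csum_unique _ _ _ H1).
      refine (is_series_ext (V := C_NormedModule) _ _ _ _ H2).
      intros k. change (z0 * (z0 ^ k * a (S (0 + k))) = z0 * z0 ^ k * a (S k))%C.
      simpl. ring. }
    rewrite <- E. ring. }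
  set (g := fun z => csum_value (fun n => z ^ n * b n)%C).
  assert (Hg : forall z, Cmod z < r -> csum (fun n => z ^ n * b n)%C (g z)).
  { intros z Hz.
    destruct (csum_geometric_bound (fun n => z ^ n * b n)%C
       (M / (r - Cmod z0)) (Cmod z / r)) as [l [Hl _]].
    - apply ratio_lt1, Hz.
    - intros n. apply term_bound, Hb.
    - unfold g. rewrite (csum_value_correct _ _ Hl). exact Hl. }
  clearbody g. exists g. split.
  { exists b. split; [exact Hb | exact Hg]. }
  (* multiplying the series of g by z - z0 gives back that of f, coefficient by
     coefficient, by Hrec *)
  intros z Hz. specialize (Hg z Hz).
  assert (H1 := csum_shift _ _ (Hf z Hz)). simpl in H1.
  assert (H2 := is_series_scal (V := C_NormedModule) z _ _ Hg).
  assert (H3 := is_series_scal (V := C_NormedModule) (- z0)%C _ _ (csum_shift _ _ Hg)).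
  assert (H4 := is_series_plus (V := C_NormedModule) _ _ _ _ H2 H3).
  assert (E : (f z - 1 * a 0%nat = z * g z + - z0 * (g z - 1 * b 0%nat))%C).
  { apply (csum_unique _ _ _ H1).
    refine (is_series_ext (V := C_NormedModule) _ _ _ _ H4).
    intros k.
    change (z * (z ^ k * b k) + (- z0) * (z ^ S k * b (S k)) = z * z ^ k * a (S k))%C.
    rewrite <- Hrec, Cpow_S. ring. }
  replace (f z) with ((f z - 1 * a 0%nat) + a 0%nat)%C by ring.
  rewrite E, Hb0. ring.
Qed.

(** * Polar coordinates *)

Lemma cis_plus x y : cis (x + y) = (cis x * cis y)%C.
Proof.
  unfold cis, Cmult; simpl. rewrite cos_plus, sin_plus. f_equal; ring.
Qed.

Lemma cis_0 : cis 0 = RtoC 1.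
Proof. unfold cis. rewrite cos_0, sin_0. reflexivity. Qed.

Lemma cis_opp_l x : (cis (- x) * cis x)%C = RtoC 1.
Proof. rewrite <- cis_plus, Rplus_opp_l. apply cis_0. Qed.

Lemma cis_pow phi n : (cis phi ^ n)%C = cis (INR n * phi).
Proof.
  induction n.
  - simpl. rewrite Rmult_0_l, cis_0. reflexivity.
  - rewrite Cpow_S, IHn, S_INR, Rmult_plus_distr_r, Rmult_1_l, cis_plus. ring.
Qed.

Lemma Cmod_cis phi : Cmod (cis phi) = 1.
Proof.
  unfold Cmod, cis; simpl. generalize (sin2_cos2 phi). unfold Rsqr. intros H.
  replace (_ + _) with 1 by lra. apply sqrt_1.
Qed.

Lemma polar_form (w : C) :
  exists psi, - PI <= psi <= PI /\ w = (RtoC (Cmod w) * cis psi)%C.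
Proof.
  destruct (Req_dec (Cmod w) 0) as [H0|H0].
  - exists 0. split; [generalize PI_RGT_0; lra|].
    rewrite H0. rewrite (Cmod_eq_0 w H0). ring.
  - assert (Hp : 0 < Cmod w) by (generalize (Cmod_ge_0 w); lra).
    destruct w as [x y]. set (m := Cmod (x, y)) in *.
    assert (Hm : m * m = x * x + y * y).
    { generalize (Cmod2_alt (x, y)). fold m. simpl. lra. }
    assert (Hx : -1 <= x / m <= 1).
    { split; [apply Rle_div_r | apply Rle_div_l]; nra. }
    assert (Hs : m * sqrt (1 - (x / m)²) = Rabs y).
    { rewrite <- (Rabs_pos_eq m) at 1 by lra. rewrite <- sqrt_Rsqr_abs.
      rewrite <- sqrt_Rsqr_abs, <- sqrt_mult.
      - f_equal. unfold Rsqr.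
        replace (m * m * (1 - x / m * (x / m))) with (m * m - x * x) by (field; lra).
        lra.
      - apply Rle_0_sqr.
      - unfold Rsqr. nra. }
    assert (Hb := acos_bound (x / m)).
    destruct (Rle_dec 0 y) as [Hy|Hy].
    + exists (acos (x / m)). split; [generalize PI_RGT_0; lra|].
      unfold cis. rewrite cos_acos, sin_acos by lra.
      unfold Cmult, RtoC; simpl. f_equal; [field; lra|].
      rewrite Hs, Rabs_pos_eq; lra.
    + exists (- acos (x / m)). split; [generalize PI_RGT_0; lra|].
      unfold cis. rewrite cos_neg, sin_neg, cos_acos, sin_acos by lra.
      unfold Cmult, RtoC; simpl. f_equal; [field; lra|].
      rewrite Rmult_0_l, Rplus_0_r, Ropp_mult_distr_r_reverse, Hs, Rabs_left; lra.
Qed.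

(** * Minima of real linear forms of analytic functions *)

(** If g z0 <> 0, choose the argument phi of h so that h^(k+1) turns v * g z0 onto
    the negative real axis: then Re (v * h^(k+1) * g z0) = - |h|^(k+1) |v * g z0|,
    and for small h the Lipschitz error, of order |h|^(k+2), cannot make up
    for it. *)
Lemma leading_factor_zero (g : C -> C) (v z0 : C) (r L : R) (k : nat) :
  0 < r -> 0 <= L -> v <> RtoC 0 ->
  (forall h, Cmod h < r -> Cmod (g (z0 + h) - g z0)%C <= L * Cmod h) ->
  (forall h, Cmod h < r -> 0 <= Re (v * (h ^ S k * g (z0 + h)))%C) ->
  g z0 = RtoC 0.
Proof.
  intros Hr HL Hv Hlip Hpos.
  apply NNPP; intros Hg.
  set (w := (v * g z0)%C).
  assert (Hw : 0 < Cmod w).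
  { unfold w. rewrite Cmod_mult.
    apply Rmult_lt_0_compat; apply Cmod_gt_0; assumption. }
  destruct (polar_form w) as [beta [_ Hbeta]].
  assert (Hk : INR (S k) <> 0) by (apply not_0_INR; lia).
  set (phi := (PI - beta) / INR (S k)).
  set (B := Cmod v * L).
  assert (HB : 0 <= B) by (apply Rmult_le_pos; [apply Cmod_ge_0 | exact HL]).
  set (t := Rmin (r / 2) (Cmod w / (2 * (B + 1)))).
  assert (Ht : 0 < t).
  { apply Rmin_pos; [lra|]. apply Rdiv_lt_0_compat; lra. }
  assert (Htr : t < r) by (generalize (Rmin_l (r/2) (Cmod w / (2 * (B + 1)))); fold t; lra).
  assert (HtB : t * (2 * (B + 1)) <= Cmod w).
  { apply Rle_div_r; [lra|]. apply Rmin_r. }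
  set (h := (RtoC t * cis phi)%C).
  assert (Hh : Cmod h = t).
  { unfold h. rewrite Cmod_mult, Cmod_cis, Cmod_R, Rabs_pos_eq; lra. }
  assert (Hhk : (h ^ S k = RtoC (t ^ S k) * cis (PI - beta))%C).
  { unfold h. rewrite Cpow_mult_l, cis_pow, RtoC_pow. f_equal. f_equal.
    unfold phi. field. exact Hk. }
  specialize (Hlip h). specialize (Hpos h). rewrite Hh in *.
  specialize (Hlip Htr). specialize (Hpos Htr).
  assert (Hmain : (h ^ S k * w = - RtoC (t ^ S k * Cmod w))%C).
  { rewrite Hbeta at 1. rewrite Hhk.
    generalize (Cmod w) (t ^ S k). intros m s.
    unfold cis, Cmult, RtoC, Copp; simpl.
    rewrite Rtrigo_facts.cos_pi_minus, Rtrigo_facts.sin_pi_minus.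
    generalize (sin2_cos2 beta); unfold Rsqr; intros E.
    f_equal; [|ring].
    transitivity (- (s * m) * (sin beta * sin beta + cos beta * cos beta)); [ring|].
    rewrite E. ring. }
  assert (Herr : Rabs (Re (v * (h ^ S k * (g (z0 + h) - g z0))))%C
                 <= t ^ S k * (B * t)).
  { eapply Rle_trans; [apply re_le_Cmod|].
    rewrite !Cmod_mult, Cmod_pow, Hh. unfold B.
    replace (t ^ S k * (Cmod v * L * t)) with (Cmod v * (t ^ S k * (L * t))) by ring.
    apply Rmult_le_compat_l; [apply Cmod_ge_0|].
    apply Rmult_le_compat_l; [apply pow_le; lra | exact Hlip]. }
  replace (v * (h ^ S k * g (z0 + h)))%C
    with (h ^ S k * w + v * (h ^ S k * (g (z0 + h) - g z0)))%C in Hpos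
    by (unfold w; ring).
  rewrite Hmain in Hpos.
  set (e := (v * (h ^ S k * (g (z0 + h) - g z0)))%C) in *.
  assert (E : Re (- RtoC (t ^ S k * Cmod w) + e)%C = - (t ^ S k * Cmod w) + Re e)
    by (unfold Re; simpl; ring).
  rewrite E in Hpos.
  assert (Htk : 0 < t ^ S k) by (apply pow_lt, Ht).
  assert (Re e <= t ^ S k * (B * t)).
  { eapply Rle_trans; [apply Rle_abs | exact Herr]. }
  assert (B * t < Cmod w) by nra.
  nra.
Qed.

Lemma expands_lipschitz M r f z0 :
  expands M r f -> Cmod z0 < r ->
  exists L, 0 <= L /\ forall h, Cmod h < (r - Cmod z0) / 2 ->
    Cmod (f (z0 + h) - f z0)%C <= L * Cmod h.
Proof.
  intros Hf Hz0.
  destruct (divided_difference M r f z0 Hf Hz0) as [g [Hg Efg]].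
  set (s := Cmod z0) in *.
  assert (Hs : 0 <= s) by apply Cmod_ge_0.
  assert (HM : 0 <= M).
  { destruct Hf as [a [Ha _]]. specialize (Ha 0%nat). simpl in Ha.
    generalize (Cmod_ge_0 (a 0%nat)). lra. }
  exists (M / (r - s) / (1 - (r + s) / 2 / r)).
  assert (Hq : 0 < 1 - (r + s) / 2 / r).
  { replace (1 - (r + s) / 2 / r) with ((r - s) / 2 / r) by (field; lra).
    apply Rdiv_lt_0_compat; lra. }
  assert (HK : 0 <= M / (r - s)) by (apply Rdiv_le_0_compat; lra).
  split.
  { apply Rdiv_le_0_compat; lra. }
  intros h Hh.
  assert (Hzh : Cmod (z0 + h)%C <= (r + s) / 2).
  { eapply Rle_trans; [apply Cmod_triangle|]. fold s. lra. }
  rewrite Efg by lra.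
  replace (f z0 + (z0 + h - z0) * g (z0 + h)%C - f z0)%C with (g (z0 + h) * h)%C by ring.
  rewrite Cmod_mult.
  apply Rmult_le_compat_r; [apply Cmod_ge_0|].
  eapply Rle_trans; [apply (expands_bound _ _ _ _ Hg); lra|].
  apply Rmult_le_compat_l; [exact HK|].
  apply Rinv_le_contravar; [exact Hq|].
  apply Rplus_le_compat_l, Ropp_le_contravar.
  apply Rmult_le_compat_r; [left; apply Rinv_0_lt_compat; lra | exact Hzh].
Qed.

(** Induction on k: at a minimum of Re (v * f) the last cofactor vanishes at z0 by
    [leading_factor_zero], so it can be divided by z - z0 once more. *)
Lemma vanishing_to_all_orders M r f v z0 :
  expands M r f -> Cmod z0 < r -> v <> RtoC 0 ->
  (forall z, Cmod z < r -> Re (v * f z0)%C <= Re (v * f z)%C) ->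
  forall k, exists g, expands (M / (r - Cmod z0) ^ S k) r g /\
    forall z, Cmod z < r -> f z = (f z0 + (z - z0) ^ S k * g z)%C.
Proof.
  intros Hf Hz0 Hv Hmin k. induction k as [|k [g [Hg Efg]]].
  - destruct (divided_difference M r f z0 Hf Hz0) as [g [Hg Efg]].
    exists g. rewrite pow_1. split; [exact Hg|].
    intros z Hz. rewrite Cpow_1_r. apply Efg, Hz.
  - assert (Hg0 : g z0 = RtoC 0).
    { destruct (expands_lipschitz _ _ _ _ Hg Hz0) as [L [HL Hlip]].
      apply (leading_factor_zero g v z0 ((r - Cmod z0) / 2) L k); auto.
      { lra. }
      intros h Hh.
      assert (Hzh : Cmod (z0 + h)%C < r).
      { eapply Rle_lt_trans; [apply Cmod_triangle|].
        generalize (Cmod_ge_0 h). lra. }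
      specialize (Hmin _ Hzh). rewrite (Efg _ Hzh) in Hmin.
      replace (z0 + h - z0)%C with h in Hmin by ring.
      replace (v * (f z0 + h ^ S k * g (z0 + h)))%C
        with (v * f z0 + v * (h ^ S k * g (z0 + h)))%C in Hmin by ring.
      unfold Re in *. simpl in Hmin |- *. lra. }
    destruct (divided_difference _ _ _ _ Hg Hz0) as [g' [Hg' Egg]].
    exists g'. split.
    + replace (M / (r - Cmod z0) ^ S (S k))
        with (M / (r - Cmod z0) ^ S k / (r - Cmod z0)); [exact Hg'|].
      simpl. field. split; [apply pow_nonzero|]; lra.
    + intros z Hz. rewrite (Efg z Hz), (Egg z Hz), Hg0, (Cpow_S _ (S k)). ring.
Qed.

(** With d = r - |z0| and |z - z0| <= d / 2, the factor (z - z0)^k gains (d / 2)^k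
    and the cofactor costs only d^-k, so |f z - f z0| is at most K / 2^k for
    every k. *)
Lemma locally_constant_at_minimum M r f v z0 z :
  expands M r f -> Cmod z0 < r -> v <> RtoC 0 ->
  (forall z, Cmod z < r -> Re (v * f z0)%C <= Re (v * f z)%C) ->
  Cmod (z - z0)%C <= (r - Cmod z0) / 2 -> f z = f z0.
Proof.
  intros Hf Hz0 Hv Hmin Hz.
  assert (Hzr : Cmod z < r).
  { replace z with (z0 + (z - z0))%C by ring.
    eapply Rle_lt_trans; [apply Cmod_triangle|]. lra. }
  set (d := r - Cmod z0) in *. assert (Hd : 0 < d) by (unfold d; lra).
  set (K := M / (1 - Cmod z / r)).
  assert (Hq := ratio_lt1 _ _ Hzr).
  assert (Hb : forall k, Cmod (f z - f z0)%C <= K * (/ 2) ^ S k).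
  { intros k.
    destruct (vanishing_to_all_orders M r f v z0 Hf Hz0 Hv Hmin k) as [g [Hg Efg]].
    rewrite (Efg z Hzr).
    replace (f z0 + (z - z0) ^ S k * g z - f z0)%C with ((z - z0) ^ S k * g z)%C by ring.
    rewrite Cmod_mult, Cmod_pow.
    apply Rle_trans with ((d / 2) ^ S k * (M / d ^ S k / (1 - Cmod z / r))).
    - apply Rmult_le_compat; [apply pow_le, Cmod_ge_0 | apply Cmod_ge_0 | |].
      + apply pow_incr. split; [apply Cmod_ge_0 | exact Hz].
      + exact (expands_bound _ _ _ _ Hg Hzr).
    - right. unfold K. set (q := 1 - _) in *. assert (q <> 0) by (unfold q; lra).
      unfold Rdiv at 1. rewrite Rpow_mult_distr. field.
      split; [assumption | apply pow_nonzero; lra]. }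
  assert (Hle : Cmod (f z - f z0)%C <= 0).
  { change (Rbar_le (Cmod (f z - f z0)%C) 0).
    apply (is_lim_seq_le (fun _ => Cmod (f z - f z0)%C) (fun k => K * (/ 2) ^ S k)).
    - exact Hb.
    - apply is_lim_seq_const.
    - replace (Finite 0) with (Rbar_mult K 0) by (simpl; f_equal; ring).
      apply is_lim_seq_scal_l.
      apply (is_lim_seq_incr_1 (fun k => (/ 2) ^ k)).
      apply is_lim_seq_geom. rewrite Rabs_pos_eq; lra. }
  assert (E : (f z - f z0)%C = RtoC 0).
  { apply Cmod_eq_0. generalize (Cmod_ge_0 (f z - f z0)%C). lra. }
  replace (f z) with ((f z - f z0) + f z0)%C by ring. rewrite E. ring.
Qed.

Lemma univalent_no_minimum (f : C -> C) (v z0 : C) :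
  class_S f -> unit_disk z0 -> v <> RtoC 0 ->
  ~ (forall z, unit_disk z -> Re (v * f z0)%C <= Re (v * f z)%C).
Proof.
  intros [[_ Hinj] [a [_ [_ Ha]]]] Hz0 Hv Hmin.
  unfold unit_disk in *.
  assert (Hs := Cmod_ge_0 z0).
  (* The terms of a series that converges at r, |z0| < r < 1, are bounded: this
     is the Cauchy estimate on the disk of radius r. *)
  set (s := Cmod z0) in *. set (r := (1 + s) / 2).
  assert (Hser : forall z, Cmod z < 1 -> csum (fun n => z ^ n * a n)%C (f z)).
  { intros z Hz. refine (is_series_ext (V := C_NormedModule) _ _ _ _ (Ha z Hz)).
    intros n. change (@pow_n C_Ring z n * a n = z ^ n * a n)%C.
    rewrite pow_n_Cpow. reflexivity. }
  assert (Hr : 0 < r < 1) by (unfold r; lra).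
  assert (Hf : exists M, expands M r f).
  { destruct (csum_terms_bounded _ _ (Hser (RtoC r) ltac:(rewrite Cmod_R, Rabs_pos_eq; lra)))
      as [M HM].
    exists M, a. split.
    - intros n. specialize (HM n).
      rewrite Cmod_mult, Cmod_pow, Cmod_R, Rabs_pos_eq in HM by lra.
      rewrite pow_inv. apply Rle_div_r; [apply pow_lt; lra|]. lra.
    - intros z Hz. apply Hser. lra. }
  destruct Hf as [M Hf].
  set (e := (r - s) / 2). assert (He : 0 < e) by (unfold e, r; lra).
  assert (Hz : Cmod (z0 + RtoC e)%C < 1).
  { eapply Rle_lt_trans; [apply Cmod_triangle|].
    rewrite Cmod_R, Rabs_pos_eq by lra. fold s. unfold e, r. lra. }
  assert (E : f (z0 + RtoC e)%C = f z0).
  { apply (locally_constant_at_minimum M r f v z0); auto.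
    - fold s. unfold r. lra.
    - intros z Hzr. apply Hmin. lra.
    - replace (z0 + RtoC e - z0)%C with (RtoC e) by ring.
      rewrite Cmod_R, Rabs_pos_eq by lra. fold s e. lra. }
  apply Hinj in E; auto.
  assert (E' : RtoC e = RtoC 0).
  { replace (RtoC e) with ((z0 + RtoC e) - z0)%C by ring. rewrite E. ring. }
  apply RtoC_inj in E'. lra.
Qed.

(** * Plane convex sets and half-planes *)

Lemma inner_coord (u w : C) :
  Re (Cconj u * w)%C = fst u * fst w + snd u * snd w.
Proof. destruct u, w. unfold Re, Cconj, Cmult; simpl. ring. Qed.

(** Take coordinates centred at p with X-axis along p - q.  On the line Y = 0 the
    set A stays in X < 0, as p would otherwise lie between q and a point of A.  A
    segment of A from the side Y > 0 to the side Y < 0 crosses that line at a point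
    with X < 0, which says that the slope X / Y at its first end is less than the
    slope at its second end.  The supremum m of the slopes over the side Y > 0
    therefore separates them, and A lies in X <= m Y.  If A has no point on one of
    the two sides, the line Y = 0 itself separates. *)
Lemma convex_separation (A : C -> Prop) (q p : C) :
  convex_set A -> A q -> ~ A p ->
  exists n : C, n <> RtoC 0 /\
    forall w, A w -> Re (Cconj n * p)%C <= Re (Cconj n * w)%C.
Proof.
  intros HA Hq Hp.
  destruct p as [p1 p2], q as [q1 q2].
  set (d1 := p1 - q1). set (d2 := p2 - q2).
  set (X := fun w : C => d1 * (fst w - p1) + d2 * (snd w - p2)).
  set (Y := fun w : C => - d2 * (fst w - p1) + d1 * (snd w - p2)).
  assert (Hd : 0 < d1 * d1 + d2 * d2).
  { destruct (Req_dec d1 0) as [H1|H1]; [|nra].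
    destruct (Req_dec d2 0) as [H2|H2]; [|nra].
    exfalso. apply Hp. replace (p1, p2) with (q1, q2); [exact Hq|].
    unfold d1, d2 in *. f_equal; lra. }
  assert (Hp0 : forall w : C, X w = 0 -> Y w = 0 -> w = (p1, p2)).
  { intros [w1 w2]. unfold X, Y. simpl. intros E1 E2.
    f_equal.
    - apply Rminus_diag_uniq, (Rmult_eq_reg_l (d1 * d1 + d2 * d2)); [|lra].
      transitivity (d1 * (d1 * (w1 - p1) + d2 * (w2 - p2))
                    - d2 * (- d2 * (w1 - p1) + d1 * (w2 - p2))); [ring|].
      rewrite E1, E2. ring.
    - apply Rminus_diag_uniq, (Rmult_eq_reg_l (d1 * d1 + d2 * d2)); [|lra].
      transitivity (d2 * (d1 * (w1 - p1) + d2 * (w2 - p2))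
                    + d1 * (- d2 * (w1 - p1) + d1 * (w2 - p2))); [ring|].
      rewrite E1, E2. ring. }
  assert (HXc : forall (u w : C) t,
    X (RtoC (1 - t) * u + RtoC t * w)%C = (1 - t) * X u + t * X w).
  { intros [u1 u2] [w1 w2] t. unfold X; simpl. ring. }
  assert (HYc : forall (u w : C) t,
    Y (RtoC (1 - t) * u + RtoC t * w)%C = (1 - t) * Y u + t * Y w).
  { intros [u1 u2] [w1 w2] t. unfold Y; simpl. ring. }
  assert (HXq : X (q1, q2) = - (d1 * d1 + d2 * d2)).
  { unfold X; simpl. unfold d1, d2; ring. }
  assert (HYq : Y (q1, q2) = 0).
  { unfold Y; simpl. unfold d1, d2; ring. }
  assert (Hline : forall w, A w -> Y w = 0 -> X w < 0).
  { intros w Hw HY. apply Rnot_le_lt. intros HX.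
    set (D := d1 * d1 + d2 * d2) in *.
    (* the parameter at which the segment from q to w passes through p *)
    set (t := D / (D + X w)).
    assert (Ht : t * (D + X w) = D) by (unfold t; field; lra).
    apply Hp. rewrite <- (Hp0 (RtoC (1 - t) * (q1, q2) + RtoC t * w)%C).
    - apply HA; auto. split; nra.
    - rewrite HXc, HXq. nra.
    - rewrite HYc, HYq, HY. ring. }
  assert (Hcross : forall u w, A u -> A w -> 0 < Y u -> Y w < 0 ->
             X u / Y u < X w / Y w).
  { intros u w Hu Hw HYu HYw.
    (* the parameter at which the segment from u to w meets the line Y = 0 *)
    set (t := Y u / (Y u - Y w)).
    assert (Ht : t * (Y u - Y w) = Y u) by (unfold t; field; lra).
    assert (Hneg : X (RtoC (1 - t) * u + RtoC t * w)%C < 0).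
    { apply Hline.
      - apply HA; auto. split; nra.
      - rewrite HYc. lra. }
    rewrite HXc in Hneg.
    assert (X w * Y u - X u * Y w < 0).
    { replace (X w * Y u - X u * Y w)
        with (((1 - t) * X u + t * X w) * (Y u - Y w)); [nra|].
      replace (((1 - t) * X u + t * X w) * (Y u - Y w))
        with (X u * (Y u - Y w) + (t * (Y u - Y w)) * (X w - X u)) by ring.
      rewrite Ht. ring. }
    assert (E : X w / Y w - X u / Y u = (X u * Y w - X w * Y u) / (Y u * - Y w)).
    { field. lra. }
    assert (0 < (X u * Y w - X w * Y u) / (Y u * - Y w)).
    { apply Rdiv_lt_0_compat; nra. }
    lra. }
  assert (Hsep : exists a b, (a <> 0 \/ b <> 0) /\
            forall w, A w -> 0 <= a * X w + b * Y w).
  { destruct (classic (exists u, A u /\ 0 < Y u)) as [[u [Hu HYu]]|Hno].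
    2:{ exists 0, (-1). split; [right; lra|]. intros w Hw.
        assert (~ 0 < Y w) by (intros H; apply Hno; eauto). lra. }
    destruct (classic (exists w, A w /\ Y w < 0)) as [[w0 [Hw0 HYw0]]|Hno].
    2:{ exists 0, 1. split; [right; lra|]. intros w Hw.
        assert (~ Y w < 0) by (intros H; apply Hno; eauto). lra. }
    destruct (completeness (fun m => exists x, A x /\ 0 < Y x /\ m = X x / Y x))
      as [m [Hm1 Hm2]].
    - exists (X w0 / Y w0). intros m [x [Hx [HYx ->]]]. left. auto.
    - exists (X u / Y u), u. auto.
    - exists (-1), m. split; [left; lra|]. intros w Hw.
      destruct (Rtotal_order (Y w) 0) as [HY|[HY|HY]].
      + assert (m <= X w / Y w).
        { apply Hm2. intros m' [x [Hx [HYx ->]]]. left. auto. }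
        assert (E : X w = X w / Y w * Y w) by (field; lra).
        nra.
      + rewrite HY. generalize (Hline w Hw HY). lra.
      + assert (X w / Y w <= m) by (apply Hm1; eauto).
        assert (E : X w = X w / Y w * Y w) by (field; lra).
        nra. }
  destruct Hsep as [a [b [Hab Hsep]]].
  exists (a * d1 - b * d2, a * d2 + b * d1). split.
  - intros E. injection E as E1 E2.
    assert (E3 : (a * a + b * b) * (d1 * d1 + d2 * d2) = 0).
    { transitivity ((a * d1 - b * d2) * (a * d1 - b * d2)
                    + (a * d2 + b * d1) * (a * d2 + b * d1)); [ring|].
      rewrite E1, E2. ring. }
    apply Rmult_integral in E3.
    assert (0 < a * a + b * b); [|lra].
    destruct Hab; nra.
  - intros w Hw. rewrite !inner_coord. simpl.
    specialize (Hsep w Hw). unfold X, Y in Hsep. lra.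
Qed.

Lemma inner_cis_polar (a b rho : R) (w0 : C) :
  Re (Cconj (cis a) * (w0 + RtoC rho * cis b))%C
  = Re (Cconj (cis a) * w0)%C + rho * cos (b - a).
Proof.
  rewrite !inner_coord. destruct w0. unfold cis; simpl. rewrite cos_minus. ring.
Qed.

(** Two half-planes whose normals make an angle delta in (0, PI) meet in a sector of
    aperture PI - delta whose axis bisects the normals.  In polar coordinates about
    the vertex, with the angle psi counted from the axis, the two inequalities read
    cos (psi + delta/2) > 0 and cos (psi - delta/2) > 0. *)
Lemma wedge_in_sector (alpha delta c1 c2 : R) :
  0 < delta < PI ->
  exists w0, forall w : C,
    c1 < Re (Cconj (cis alpha) * w)%C ->
    c2 < Re (Cconj (cis (alpha + delta)) * w)%C ->
    sector w0 (alpha + delta / 2) (PI - delta) w.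
Proof.
  intros Hd.
  assert (Hsin : 0 < sin delta) by (apply sin_gt_0; lra).
  set (beta := alpha + delta).
  assert (Hdet : cos alpha * sin beta - sin alpha * cos beta = sin delta).
  { replace delta with (beta - alpha) by (unfold beta; ring). rewrite sin_minus. ring. }
  (* the vertex, by Cramer's rule *)
  set (w0 := ((c1 * sin beta - c2 * sin alpha) / sin delta,
              (c2 * cos alpha - c1 * cos beta) / sin delta) : C).
  assert (E1 : Re (Cconj (cis alpha) * w0)%C = c1).
  { rewrite inner_coord. unfold w0, cis; simpl.
    transitivity (c1 * (cos alpha * sin beta - sin alpha * cos beta) / sin delta);
      [field; lra|]. rewrite Hdet. field. lra. }
  assert (E2 : Re (Cconj (cis beta) * w0)%C = c2).
  { rewrite inner_coord. unfold w0, cis; simpl.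
    transitivity (c2 * (cos alpha * sin beta - sin alpha * cos beta) / sin delta);
      [field; lra|]. rewrite Hdet. field. lra. }
  exists w0. intros w H1 H2.
  set (mid := alpha + delta / 2).
  destruct (polar_form ((w - w0) * cis (- mid))%C) as [psi [Hpsi Ew]].
  set (rho := Cmod _) in Ew.
  assert (Hrho : 0 <= rho) by apply Cmod_ge_0.
  assert (Ew' : w = (w0 + RtoC rho * cis (psi + mid))%C).
  { rewrite cis_plus.
    transitivity (w0 + (w - w0) * (cis (- mid) * cis mid))%C.
    - rewrite cis_opp_l. ring.
    - rewrite !Cmult_assoc, Ew. ring. }
  rewrite Ew', inner_cis_polar in H1, H2. rewrite E1 in H1. rewrite E2 in H2.
  replace (psi + mid - alpha) with (psi + delta / 2) in H1 by (unfold mid; ring).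
  replace (psi + mid - beta) with (psi - delta / 2) in H2 by (unfold mid, beta; field).
  assert (C1 : 0 < cos (psi + delta / 2)) by nra.
  assert (C2 : 0 < cos (psi - delta / 2)) by nra.
  exists rho, (psi + mid). split; [nra|]. split; [|exact Ew'].
  replace (psi + mid - mid) with psi by ring.
  apply Rabs_def1; apply Rnot_le_lt; intros H.
  - assert (cos (psi + delta / 2) <= 0) by (apply cos_le_0; lra). lra.
  - assert (cos (- (psi - delta / 2)) <= 0) by (apply cos_le_0; lra).
    rewrite cos_neg in *. lra.
Qed.

(** Measuring the direction of n from alpha with values in [-PI, PI] leaves parallel
    normals as the cases delta = 0, PI, -PI, and the sign of delta tells the order
    of the two normals in the other cases. *)
Lemma relative_direction (alpha : R) (n : C) :
  n <> RtoC 0 ->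
  exists m delta, 0 < m /\ - PI <= delta <= PI /\
    forall w, Re (Cconj n * w)%C = m * Re (Cconj (cis (alpha + delta)) * w)%C.
Proof.
  intros Hn.
  destruct (polar_form (n * cis (- alpha))%C) as [delta [Hd En]].
  exists (Cmod (n * cis (- alpha))%C), delta.
  split; [|split; [exact Hd|]].
  - rewrite Cmod_mult, Cmod_cis, Rmult_1_r. apply Cmod_gt_0, Hn.
  - intros w. set (m := Cmod _) in *. clearbody m.
    assert (E : n = (RtoC m * cis (alpha + delta))%C).
    { rewrite cis_plus.
      transitivity (n * (cis (- alpha) * cis alpha))%C.
      - rewrite cis_opp_l. ring.
      - rewrite Cmult_assoc, En. ring. }
    rewrite E, !inner_coord. unfold cis; simpl. ring.
Qed.

(** Since the infimum is finite, the set of admissible apertures is nonempty; since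
    it equals the largest allowed aperture PI, no smaller one is admissible. *)
Lemma angle_PI_inv (Omega : C -> Prop) :
  angle_at_infinity Omega = Finite PI ->
  (exists w0 phi0, Defs.included Omega (sector w0 phi0 PI)) /\
  forall theta A, 0 <= theta < PI -> is_sector_of_aperture theta A ->
    ~ Defs.included Omega A.
Proof.
  unfold angle_at_infinity.
  set (E := fun theta : R => 0 <= theta <= PI /\
    exists A, is_sector_of_aperture theta A /\ Defs.included Omega A).
  intros HE. destruct (Glb_Rbar_correct E) as [Hlb Hglb]. rewrite HE in Hlb, Hglb.
  assert (Hmin : forall theta A, 0 <= theta < PI -> is_sector_of_aperture theta A ->
    ~ Defs.included Omega A).
  { intros theta A Ht HA Hincl.
    assert (Hin : E theta) by (split; [lra | exists A; split; assumption]).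
    specialize (Hlb theta Hin). simpl in Hlb. lra. }
  split; [|exact Hmin].
  assert (Hex : exists theta, E theta).
  { apply NNPP; intros Hno.
    (* otherwise +oo would be a lower bound *)
    change (Rbar_le p_infty PI).
    apply Hglb. intros x Hx. exfalso. eauto. }
  destruct Hex as [theta [Ht [A [HA Hincl]]]].
  destruct (Rlt_dec theta PI) as [Hlt|Hge].
  - exfalso. apply (Hmin theta A); auto. lra.
  - assert (theta = PI) by lra. subst theta.
    destruct HA as [[_ [w0 [phi0 HS]]]|[H0 _]].
    + exists w0, phi0. intros w Hw. apply HS, Hincl, Hw.
    + generalize PI_RGT_0; lra.
Qed.

Lemma cis_neq_0 a : cis a <> RtoC 0.
Proof. apply Cmod_gt_0. rewrite Cmod_cis. lra. Qed.

Lemma inner_cis_opp a w :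
  Re (Cconj (cis (a + PI)) * w)%C = - Re (Cconj (cis a) * w)%C.
Proof. rewrite !inner_coord. unfold cis; simpl. rewrite neg_cos, neg_sin. ring. Qed.

(** Omega lies between an open half-plane and its closure: a missing point of the
    open half-plane would, by separation, put Omega inside a strip, inside a
    sector of aperture < PI, or inside a smaller parallel half-plane. *)
Lemma convex_angle_PI (Omega : C -> Prop) (q : C) :
  convex_set Omega -> Omega q -> angle_at_infinity Omega = Finite PI ->
  exists (u : C) (m : R), u <> RtoC 0 /\
    (forall w, Omega w -> m <= Re (Cconj u * w)%C) /\
    (forall w, m < Re (Cconj u * w)%C -> Omega w).
Proof.
  intros Hconv Hq Hangle.
  destruct (angle_PI_inv _ Hangle) as [[w1 [alpha Hsec]] Hmin].
  set (c := Re (Cconj (cis alpha) * w1)%C).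
  assert (Hc : forall w, Omega w -> c < Re (Cconj (cis alpha) * w)%C).
  { intros w Hw. destruct (Hsec w Hw) as [rho [phi [Hrho [Hphi ->]]]].
    rewrite inner_cis_polar. fold c.
    apply Rabs_def2 in Hphi.
    assert (0 < cos (phi - alpha)) by (apply cos_gt_0; lra). nra. }
  (* completeness is stated for suprema: m is minus the infimum of the form *)
  destruct (completeness (fun x => exists w, Omega w /\ x = - Re (Cconj (cis alpha) * w)%C))
    as [m [Hm1 Hm2]].
  { exists (- c). intros x [w [Hw ->]]. specialize (Hc w Hw). lra. }
  { exists (- Re (Cconj (cis alpha) * q)%C), q. auto. }
  exists (cis alpha), (- m). split; [apply cis_neq_0|]. split.
  { intros w Hw.
    assert (- Re (Cconj (cis alpha) * w)%C <= m) by (apply Hm1; eauto). lra. }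
  intros p Hp. apply NNPP; intros HpO.
  destruct (convex_separation Omega q p Hconv Hq HpO) as [n [Hn Hsep]].
  destruct (relative_direction alpha n Hn) as [k [delta [Hk [Hd Ek]]]].
  assert (Hsep' : forall w, Omega w -> Re (Cconj (cis (alpha + delta)) * p)%C
                    <= Re (Cconj (cis (alpha + delta)) * w)%C).
  { intros w Hw. specialize (Hsep w Hw). rewrite !Ek in Hsep. nra. }
  clear Hsep Ek Hn.
  assert (HPI := PI_RGT_0).
  (* subtracting 1 makes the separating inequality strict, as sectors are open *)
  set (c' := Re (Cconj (cis (alpha + delta)) * p)%C - 1).
  assert (Hc' : forall w, Omega w -> c' < Re (Cconj (cis (alpha + delta)) * w)%C).
  { intros w Hw. specialize (Hsep' w Hw). unfold c'. lra. }
  assert (Hstrip : forall c2, ~ forall w, Omega w -> Re (Cconj (cis alpha) * w)%C < c2).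
  { intros c2 H2. apply (Hmin 0 (strip (cis alpha) c c2)); [lra| |].
    - right. split; [reflexivity|]. exists (cis alpha), c, c2.
      split; [apply cis_neq_0|]. split; [|intros w; tauto].
      specialize (Hc q Hq). specialize (H2 q Hq). lra.
    - intros w Hw. split; auto. }
  destruct (Req_dec delta 0) as [->|H0].
  { rewrite Rplus_0_r in Hsep'.
    assert (m <= - Re (Cconj (cis alpha) * p)%C); [|lra].
    apply Hm2. intros x [w [Hw ->]]. specialize (Hsep' w Hw). lra. }
  destruct (Req_dec delta PI) as [->|H1].
  { apply (Hstrip (- c')). intros w Hw. specialize (Hc' w Hw).
    rewrite inner_cis_opp in Hc'. lra. }
  destruct (Req_dec delta (- PI)) as [->|H2].
  { apply (Hstrip (- c')). intros w Hw. specialize (Hc' w Hw).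
    assert (E := inner_cis_opp (alpha + - PI) w).
    replace (alpha + - PI + PI) with alpha in E by ring. lra. }
  destruct (Rlt_dec 0 delta) as [Hpos|Hneg].
  - destruct (wedge_in_sector alpha delta c c') as [w0 Hw0]; [lra|].
    apply (Hmin (PI - delta) (sector w0 (alpha + delta / 2) (PI - delta))); [lra| |].
    + left. split; [lra|]. exists w0, (alpha + delta / 2). intros w; tauto.
    + intros w Hw. apply Hw0; auto.
  - destruct (wedge_in_sector (alpha + delta) (- delta) c' c) as [w0 Hw0]; [lra|].
    replace (alpha + delta + - delta) with alpha in Hw0 by ring.
    apply (Hmin (PI - - delta) (sector w0 (alpha + delta + - delta / 2) (PI - - delta)));
      [lra| |].
    + left. split; [lra|]. exists w0, (alpha + delta + - delta / 2). intros w; tauto.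
    + intros w Hw. apply Hw0; auto.
Qed.

Theorem corollary3 (f : C -> C) (hf : class_C f)
  (htheta : angle_at_infinity (image f unit_disk) = Finite PI) :
  is_half_plane (image f unit_disk).
Proof.
  destruct hf as [HS Hconv].
  assert (H0 : image f unit_disk (f 0)).
  { exists (RtoC 0). split; [|reflexivity]. unfold unit_disk. rewrite Cmod_0. lra. }
  destruct (convex_angle_PI _ _ Hconv H0 htheta) as [u [m [Hu [Hle Hin]]]].
  exists u, m. split; [exact Hu|]. intros w. split; [|apply Hin].
  intros [z0 [Hz0 ->]]. unfold half_plane. apply Rnot_le_lt. intros Hmin.
  apply (univalent_no_minimum f (Cconj u) z0 HS Hz0).
  - intros E. apply Hu. rewrite <- (Cconj_conj u), E.
    unfold Cconj, RtoC; simpl. f_equal. ring.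
  - intros z Hz. eapply Rle_trans; [exact Hmin|]. apply Hle. exists z. auto.
Qed.
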